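(* Let $\Omega\subseteq\mathbb{R}^d$ be a domain and let $H$ be a reproducing kernel Hilbert space of functions $f:\Omega\to\mathbb{R}$ with reproducing kernel $K$. Let $H_1$ be a closed subspace of $H$ with reproducing kernel $K_1$ and let $H_2=H_1^\perp$. Let $1\le p,q\le\infty$, let $X=\{x_1,\ldots,x_N\}\subseteq\Omega$ be a set of $N$ points and let $\lambda>0$. Assume that there are a constant $C>0$ and two functions $F_1,F_2:\mathbb{N}\to[0,\infty)$ such that on $H_1$ a sampling inequality of the form $$\|g\|_{L_q(\Omega)}\le C\left[F_1(N)\|g\|_H+F_2(N)\|g\|_{\ell_p(X)}\right],\qquad g\in H_1,$$ holds. Then, for any $f=f_1+f_2\in H$ with $f_i\in H_i$, $i=1,2$, $$\|f-Q_{X,\lambda}f\|_{L_q(\Omega)}\le\|f_2\|_{L_q(\Omega)}+C\left[2F_1(N)+c_pF_2(N)\sqrt{\lambda}\right]\|f\|_H+C\left(\frac{F_1(N)}{\sqrt{\lambda}}+2c_pF_2(N)\right)\|f_2\|_{\ell_2(X)}.$$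
   Context: The regularized approximation of $f\in H$ from $H_1$ is $$Q_{X,\lambda}f:=\operatorname*{arg\,min}_{s\in H_1}\left(\sum_{j=1}^N|f(x_j)-s(x_j)|^2+\lambda\|s\|_H^2\right).$$ For a function $g$ on $\Omega$, $\|g\|_{\ell_p(X)}:=\|(g(x_1),\ldots,g(x_N))\|_p$, the usual $\ell_p$-norm on $\mathbb{R}^N$. The constant $c_p$ is the equivalence constant in $\|y\|_p\le c_p\|y\|_2$, $y\in\mathbb{R}^N$, namely $c_p=N^{1/p-1/2}$ if $1\le p\le 2$ and $c_p=1$ if $p\ge 2$. *)

(* Defs.v *)
From HB Require Import structures.
From mathcomp Require Import all_boot all_order all_algebra sesquilinear.
From mathcomp Require Import all_classical all_reals all_analysis.

Set Implicit Arguments.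
Unset Strict Implicit.
Unset Printing Implicit Defensive.

Import Order.TTheory GRing.Theory Num.Theory.
Import numFieldNormedType.Exports.

Local Open Scope classical_set_scope.
Local Open Scope ring_scope.

(* Lebesgue measure on R^n for n = d.+1 >= 1: the Caratheodory restriction of
   the outer measure given by countable covers by open boxes. Its measurable
   sets are all the Lebesgue measurable sets, not only the Borel ones. *)
Section Lebesgue.
Context (R : realType) (d : nat).
Implicit Types (c : 'rV[R]_d.+1 * 'rV[R]_d.+1) (A : set 'rV[R]_d.+1).

Definition box c : set 'rV[R]_d.+1 :=
  [set x | forall i, c.1 0 i < x 0 i < c.2 0 i].

Definition box_volume c : R := \prod_i Num.max 0 (c.2 0 i - c.1 0 i).

Definition lebesgue_outer A : \bar R :=
  ereal_inf [set (\sum_(k <oo) (box_volume (c k))%:E)%E | c in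
    [set c : nat -> 'rV[R]_d.+1 * 'rV[R]_d.+1 | A `<=` \bigcup_k box (c k)]].

Lemma box_volume_ge0 c : 0 <= box_volume c.
Proof. by apply: prodr_ge0 => i _; rewrite le_max lexx. Qed.

Lemma lebesgue_outer_ge0 A : (0 <= lebesgue_outer A)%E.
Proof.
apply: le_ereal_inf_tmp => _ [c _ <-].
by apply: nneseries_ge0 => k _ _; rewrite lee_fin box_volume_ge0.
Qed.

Lemma lebesgue_outer0 : lebesgue_outer set0 = 0%E.
Proof.
apply/eqP; rewrite eq_le lebesgue_outer_ge0 andbT.
apply: ereal_inf_lbound; exists (fun=> (0, 0)); first exact: sub0set.
rewrite eseries0// => k _ _.
by rewrite /box_volume big_ord_recl /= !mxE subrr maxxx mul0r.
Qed.

Lemma le_lebesgue_outer : {homo lebesgue_outer : A B / A `<=` B >-> (A <= B)%E}.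
Proof.
move=> A B AB; apply/ereal_inf_le_tmp => _ [c Bc <-].
by exists c => //; exact: subset_trans Bc.
Qed.

Lemma lebesgue_outer_sigma_subadditive : sigma_subadditive lebesgue_outer.
Proof.
move=> A; have [[i ioo]|] := pselect (exists i, lebesgue_outer (A i) = +oo%E).
  rewrite (eseries_pinfty _ _ ioo) ?leey// => n _.
  by rewrite -ltNye (lt_le_trans _ (lebesgue_outer_ge0 _)).
rewrite -forallNE => Aoo; apply/lee_addgt0Pr => e e0.
apply: le_trans (epsilon_trick _ _ (ltW e0)); last first.
  by move=> n; exact: lebesgue_outer_ge0.
pose P n (c : nat -> 'rV[R]_d.+1 * 'rV[R]_d.+1) :=
  A n `<=` \bigcup_k box (c k) /\
  (\sum_(k <oo) (box_volume (c k))%:E <=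
     lebesgue_outer (A n) + (e / (2 ^ n.+1)%:R)%:E)%E.
have [G PG] : {G & forall n, P n (G n)}.
  apply: (@choice _ _ P) => n.
  have en0 : (0 < e / (2 ^ n.+1)%:R)%R by rewrite divr_gt0// ltr0n expn_gt0.
  have fn : lebesgue_outer (A n) \is a fin_num.
    by rewrite ge0_fin_numE ?lebesgue_outer_ge0// ltey; exact/eqP/Aoo.
  have [_ [c Ac <-] cl] := lb_ereal_inf_adherent en0 fn.
  by exists c; split => //; exact/ltW.
have vol0 i j : (0 <= (box_volume (G i j))%:E)%E.
  by rewrite lee_fin box_volume_ge0.
have /card_esym/ppcard_eqP[f] := card_nat2.
have Gf : (lebesgue_outer (\bigcup_n A n) <=
    \sum_(k <oo) (box_volume (uncurry G (f k)))%:E)%E.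
  apply: ereal_inf_lbound; exists (uncurry G \o f) => //.
  move=> t [i _ /(PG i).1 [j _ tij]].
  by exists (f^-1%FUN (i, j)) => //=; rewrite invK ?inE.
apply: le_trans Gf _.
have volG x : (0 <= (box_volume (uncurry G x))%:E)%E.
  by rewrite lee_fin box_volume_ge0.
rewrite nneseries_esumT; last by move=> k; exact: volG.
have -> : (\esum_(k in [set: nat]) (box_volume (uncurry G (f k)))%:E =
    \esum_(x in [set: nat * nat]) (box_volume (uncurry G x))%:E)%E.
  by apply/esym/reindex_esum; exact: bij.
have -> : [set: nat * nat] = [set: nat] `*`` (fun=> [set: nat]).
  by apply/seteqP; split.
rewrite (_ : (fun x => _) = fun x => (box_volume (G x.1 x.2))%:E); last first.
  by apply/funext => -[].
rewrite -(esum_esum (a := fun i j => (box_volume (G i j))%:E)) //.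
rewrite -nneseries_esumT => [|n]; last exact: esum_ge0.
apply: lee_nneseries => [n _ _|n _]; first exact: esum_ge0.
by rewrite -nneseries_esumT//; exact: (PG n).2.
Qed.

HB.instance Definition _ := isOuterMeasure.Build R 'rV[R]_d.+1 lebesgue_outer
  lebesgue_outer0 lebesgue_outer_ge0 le_lebesgue_outer
  lebesgue_outer_sigma_subadditive.

Definition lebesgue_space := caratheodory_type lebesgue_outer.

HB.instance Definition _ := Measurable.on lebesgue_space.

Definition lebesgue_rV : set lebesgue_space -> \bar R := lebesgue_outer.

HB.instance Definition _ := isMeasure.Build _ lebesgue_space R lebesgue_rV
  lebesgue_outer0 lebesgue_outer_ge0
  (@caratheodory_measure_sigma_additive _ _ lebesgue_outer).

(* ||g||_{L_q(Omega)} for g : Omega -> R, computed on the extension of g by 0,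
   with value +oo when g is not Lebesgue measurable. *)
Definition Lq_norm (Omega : set 'rV[R]_d.+1) (q : \bar R) (g : Omega -> R) :
    \bar R :=
  let g0 : lebesgue_space -> R := 'valL_0 g in
  if `[< measurable_fun [set: lebesgue_space] g0 >]
  then 'N[lebesgue_rV]_q[EFin \o g0]%E else +oo%E.

End Lebesgue.

(* The l_p-norm on R^N for 1 <= p <= +oo, and the constant c_p with
   ||y||_p <= c_p ||y||_2; the values at p = -oo are irrelevant. *)
Definition lp_norm (R : realType) (N : nat) (p : \bar R) (y : 'I_N -> R) : R :=
  match p with
  | r%:E => (\sum_i `|y i| `^ r) `^ r^-1
  | +oo%E => \big[Num.max/0]_i `|y i|
  | -oo%E => 0
  end.

Definition lp_const (R : realType) (N : nat) (p : \bar R) : R :=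
  if p is r%:E then if r <= 2 then N%:R `^ (r^-1 - 2^-1) else 1 else 1.

(* A Hilbert space of functions T -> R: a Hilbert space whose elements are
   identified with functions through an injective linear map. *)
Record function_hilbert (R : realType) (T : Type) := FunctionHilbert {
  fh_space :> completeNormedModType R ;
  fh_dot : {dot fh_space for idfun} ;
  fh_normE : forall f : fh_space, `|f| = Num.sqrt (fh_dot f f) ;
  fh_fun : {linear fh_space -> (T -> R^o)} ;
  fh_fun_inj : injective fh_fun }.

Section FunctionHilbert.
Context (R : realType) (T : Type) (H : function_hilbert R T).
Implicit Types (A : set H) (f : H).

Definition closed_subspace A : Prop :=
  [/\ A 0, forall (a : R) f g, A f -> A g -> A (a *: f + g) & closed A].

Definition orthogonal_complement A : set H :=
  [set f | forall g, A g -> fh_dot H f g = 0].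

(* K (., x) belongs to A, and f x = <f, K (., x)> for all f in A. *)
Definition reproducing_kernel A (K : T -> T -> R) : Prop :=
  forall x, exists k, [/\ A k, fh_fun H k = K^~ x &
    forall f, A f -> fh_fun H f x = fh_dot H f k].

Definition is_argmin A (J : H -> R) : set H :=
  [set s | A s /\ forall t, A t -> J s <= J t].

(* The value 0 is a default, used only if there is no minimizer. *)
Definition argmin A (J : H -> R) : H := xget 0 (is_argmin A J).

Definition regularized_approx A (N : nat) (X : 'I_N -> T) (lambda : R) f : H :=
  argmin A (fun s => \sum_j `|fh_fun H f (X j) - fh_fun H s (X j)| ^+ 2
                     + lambda * `|s| ^+ 2).

End FunctionHilbert.

(* Main.v *)
Require Import Defs.
From HB Require Import structures.
From mathcomp Require Import all_boot all_order all_algebra sesquilinear.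
From mathcomp Require Import all_classical all_reals all_analysis.
From mathcomp Require Import ring lra measurable_realfun.

Set Implicit Arguments.
Unset Strict Implicit.
Unset Printing Implicit Defensive.

Import Order.TTheory GRing.Theory Num.Theory.
Import numFieldNormedType.Exports.

Local Open Scope classical_set_scope.
Local Open Scope ring_scope.

(** Put s := Q_{X,lambda} f and b := ||f2||_{l2(X)}. Since f - s = f2 + (f1 - s)
with f1 - s in H1, Minkowski's inequality in L_q leaves only f1 - s, to which
the sampling inequality applies; both terms of that inequality are controlled
by testing the minimality of s against the competitor f1 (argmin_energy_le):
||f - s||_{l2(X)}^2 + lambda ||s||^2 <= b^2 + lambda ||f1||^2.
This bounds ||s|| by ||f1|| + b / sqrt lambda and ||f - s||_{l2(X)} by
b + sqrt lambda ||f1|| (tradeoff_bounds). As ||f1|| <= ||f|| by orthogonality,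
- ||f1 - s|| <= 2 ||f|| + b / sqrt lambda, and
- ||f1 - s||_{l2(X)} <= ||f - s||_{l2(X)} + b <= 2 b + sqrt lambda ||f||,
and lp_norm_le_const turns the last bound into one on the l_p(X)-norm.

The argument requires that a minimizer exists, for otherwise Q_{X,lambda} f is
a mere default value. It exists by the representer theorem
(regularized_approx_argmin): with k_j in H1 the representer of evaluation at
x_j, the combination of the k_j whose coefficients solve the Gram system
shifted by lambda satisfies the normal equations, and these characterize the
minimizers of a convex quadratic functional. *)

(** * Discrete norms *)

Section LpNorm.
Context (R : realType) (N : nat).
Implicit Types (y z : 'I_N -> R) (r t : R).

Lemma lp_norm2E y : lp_norm 2%:E y = Num.sqrt (\sum_i y i ^+ 2).
Proof.
rewrite /lp_norm powR12_sqrt; last first.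
  by apply: sumr_ge0 => i _; exact: powR_ge0.
congr (Num.sqrt _); apply: eq_bigr => i _.
by rewrite powR_mulrn// real_normK ?num_real.
Qed.

Lemma lp_norm2_ge0 y : 0 <= lp_norm 2%:E y.
Proof. by rewrite lp_norm2E sqrtr_ge0. Qed.

Lemma sqr_lp_norm2 y : lp_norm 2%:E y ^+ 2 = \sum_i y i ^+ 2.
Proof. by rewrite lp_norm2E sqr_sqrtr// sumr_ge0// => i _; exact: sqr_ge0. Qed.

Lemma normr_le_lp_norm2 y i : `|y i| <= lp_norm 2%:E y.
Proof.
rewrite -ler_sqr ?nnegrE ?lp_norm2_ge0// sqr_lp_norm2.
rewrite real_normK ?num_real// (bigD1 i)//=.
by rewrite lerDl sumr_ge0// => j _; exact: sqr_ge0.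
Qed.

Lemma lp_norm2_eq0 y : lp_norm 2%:E y = 0 -> y = fun=> 0.
Proof.
move=> y0; apply/funext => i; apply/normr0_eq0/le_anti.
by rewrite normr_ge0 -y0 normr_le_lp_norm2.
Qed.

(** Instead of the Cauchy-Schwarz inequality: with A and B the norms of y and z,
each term satisfies (y_i + z_i)^2 <= (1 + B/A) y_i^2 + (1 + A/B) z_i^2, and
these bounds add up to exactly (A + B)^2. *)
Lemma ler_lp_norm2D y z :
  lp_norm 2%:E (y \+ z) <= lp_norm 2%:E y + lp_norm 2%:E z.
Proof.
move EA : (lp_norm 2%:E y) => A; move EB : (lp_norm 2%:E z) => B.
have A0 : 0 <= A by rewrite -EA lp_norm2_ge0.
have B0 : 0 <= B by rewrite -EB lp_norm2_ge0.
have [A00|AN0] := eqVneq A 0.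
  have -> : y \+ z = z.
    by apply/funext => i; rewrite /= (lp_norm2_eq0 (etrans EA A00)) add0r.
  by rewrite EB lerDr.
have [B00|BN0] := eqVneq B 0.
  have -> : y \+ z = y.
    by apply/funext => i; rewrite /= (lp_norm2_eq0 (etrans EB B00)) addr0.
  by rewrite EA lerDl.
have Ap : 0 < A by rewrite lt0r AN0.
have Bp : 0 < B by rewrite lt0r BN0.
rewrite -ler_sqr ?nnegrE ?lp_norm2_ge0 ?addr_ge0// sqr_lp_norm2.
have -> : (A + B) ^+ 2 = (1 + B / A) * A ^+ 2 + (1 + A / B) * B ^+ 2.
  by field; rewrite AN0 BN0.
have -> : A ^+ 2 = \sum_i y i ^+ 2 by rewrite -EA sqr_lp_norm2.
have -> : B ^+ 2 = \sum_i z i ^+ 2 by rewrite -EB sqr_lp_norm2.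
rewrite !mulr_sumr -big_split/=.
apply: ler_sum => i _; rewrite -subr_ge0.
have -> : (1 + B / A) * y i ^+ 2 + (1 + A / B) * z i ^+ 2 - (y i + z i) ^+ 2 =
  A * B * (y i / A - z i / B) ^+ 2 by field; rewrite AN0 BN0.
by rewrite mulr_ge0 ?sqr_ge0// mulr_ge0.
Qed.

Lemma lp_norm2N y : lp_norm 2%:E (\- y) = lp_norm 2%:E y.
Proof. by rewrite !lp_norm2E; under eq_bigr do rewrite /= sqrrN. Qed.

(** The concave map u |-> u^(r/2) lies below its tangent at u = 1, here taken at
u = t^2; this is Young's inequality for the factors t^r and 1. *)
Lemma powR_le_tangent r t : 0 < r < 2 -> 0 <= t ->
  t `^ r <= 1 - r / 2 + r / 2 * t ^+ 2.
Proof.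
move=> /andP[r0 r2] t0.
have r2' : 0 < 2 - r by rewrite subr_gt0.
have := @conjugate_powR R (t `^ r) 1 (2 / r) (2 / (2 - r)) (powR_ge0 _ _) ler01.
rewrite !divr_gt0// => /(_ isT isT); rewrite mulr1 powR1 -powRrM.
rewrite mulrCA divff ?gt_eqF// mulr1 powR_mulrn// !invf_div => H.
have {H} : t `^ r <= t ^+ 2 * (r / 2) + 1 * ((2 - r) / 2).
  by apply: H; field.
by move=> /le_trans; apply; rewrite le_eqVlt; apply/orP; left; apply/eqP; field.
Qed.

(** For p >= 2, each |y_i| is at most the l_2-norm A, so
|y_i|^p <= A^(p-2) |y_i|^2. For p < 2, normalize by the root mean square m of
y: summing the tangent bound over the |y_i| / m, whose squares add up to N,
gives that their p-th powers add up to at most N. *)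
Lemma lp_norm_le_const (p : \bar R) y : (1 <= p)%E ->
  lp_norm p y <= lp_const N p * lp_norm 2%:E y.
Proof.
case: p => [r| |] //; rewrite ?lee_fin => r1; last first.
  rewrite /lp_const mul1r; apply/bigmax_leP; split; first exact: lp_norm2_ge0.
  by move=> i _; exact: normr_le_lp_norm2.
(* Only these facts on the l_2-norm matter, so it becomes a variable A. *)
have sumA := sqr_lp_norm2 y; have leA := normr_le_lp_norm2 y.
have zeroA := @lp_norm2_eq0 y; have A0 := lp_norm2_ge0 y.
have nilA : N%:R = 0 :> R -> lp_norm 2%:E y = 0.
  move=> /eqP; rewrite pnatr_eq0 => /eqP N0; rewrite lp_norm2E big1 ?sqrtr0//.
  by move=> [i iN] _; exfalso; move: iN; rewrite N0.
move: (lp_norm 2%:E y) sumA leA zeroA A0 nilA => A sumA leA zeroA A0 nilA.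
have r0 : 0 < r by exact: lt_le_trans r1.
have rN0 : r != 0 by rewrite gt_eqF.
have powV (x : R) : 0 <= x -> (x `^ r) `^ r^-1 = x.
  by move=> x0; rewrite -powRrM mulfV// powRr1.
have mono (x z : R) : 0 <= x -> x <= z -> x `^ r^-1 <= z `^ r^-1.
  move=> x0 xz.
  by rewrite ge0_ler_powR ?invr_ge0 ?nnegrE ?(ltW r0)// (le_trans x0).
have sum0 : 0 <= \sum_i `|y i| `^ r by apply: sumr_ge0 => i _; exact: powR_ge0.
have [r2|r2] := leP 2 r.
  have le1 : lp_norm r%:E y <= A.
    rewrite -[leRHS]powV//; apply: mono => //.
    have pow2 (x : R) : 0 <= x -> x `^ r = x `^ (r - 2) * x ^+ 2.
      by move=> x0; rewrite -powR_mulrn// -powRD ?subrK ?(negPf rN0).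
    rewrite pow2// sumA mulr_sumr; apply: ler_sum => i _.
    rewrite pow2// real_normK ?num_real// ler_wpM2r ?sqr_ge0//.
    by rewrite ge0_ler_powR ?nnegrE ?subr_ge0 ?leA.
  rewrite /lp_const; case: ifPn => [r2'|_]; last by rewrite mul1r.
  have r_eq2 : r = 2 by apply/le_anti; rewrite r2 r2'.
  by rewrite [in leRHS]r_eq2 subrr powRr0 mul1r.
rewrite /lp_const (ltW r2).
have [A00|AN0] := eqVneq A 0.
  rewrite A00 mulr0 /lp_norm (zeroA A00) big1 ?powR0 ?invr_eq0// => i _.
  by rewrite normr0 powR0.
have NN0 : N%:R != 0 :> R.
  by apply: contra_neq AN0 => /nilA.
have sN0 : 0 < Num.sqrt (N%:R : R) by rewrite sqrtr_gt0 lt0r NN0 ler0n.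
have Ap : 0 < A by rewrite lt0r AN0.
pose m := A / Num.sqrt N%:R.
have mp : 0 < m by rewrite divr_gt0.
have mN : m ^+ 2 * N%:R = A ^+ 2.
  by rewrite /m expr_div_n sqr_sqrtr ?ler0n// mulfVK.
have le_sum : \sum_i `|y i| `^ r <= N%:R * m `^ r.
  have -> : \sum_i `|y i| `^ r = (\sum_i (`|y i| / m) `^ r) * m `^ r.
    rewrite mulr_suml; apply: eq_bigr => i _.
    by rewrite -powRM ?divr_ge0 ?(ltW mp)// mulfVK ?gt_eqF.
  rewrite ler_wpM2r ?powR_ge0//.
  apply: (@le_trans _ _ (\sum_(i < N) (1 - r / 2 + r / 2 * (`|y i| / m) ^+ 2))).
    by apply: ler_sum => i _; rewrite powR_le_tangent ?r0 ?divr_ge0 ?(ltW mp).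
  rewrite big_split/= -mulr_sumr sumr_const card_ord -mulr_natl.
  have -> : \sum_i (`|y i| / m) ^+ 2 = N%:R.
    under eq_bigr do rewrite expr_div_n real_normK ?num_real//.
    rewrite -mulr_suml -sumA -mN mulrAC mulfV ?mul1r//.
    by rewrite expf_neq0// gt_eqF.
  by rewrite le_eqVlt; apply/orP; left; apply/eqP; field.
apply: (le_trans (mono _ _ sum0 le_sum)).
rewrite powRM ?ler0n ?powR_ge0// powV ?(ltW mp)//.
by rewrite powRB ?NN0 ?implybT// powR12_sqrt ?ler0n// /m mulrA mulrAC.
Qed.

End LpNorm.

(** * The Lebesgue norm on a domain *)

Section LqNorm.
Context (R : realType) (d : nat) (Omega : set 'rV[R]_d.+1).
Implicit Types (g h : Omega -> R) (q : \bar R).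

Lemma Lq_norm_ge0 q g : (0 <= Lq_norm q g)%E.
Proof. by rewrite /Lq_norm; case: ifP => // _; exact: Lnorm_ge0. Qed.

Lemma Lq_norm_neqNy q g : Lq_norm q g != -oo%E.
Proof. by rewrite -ltNye (lt_le_trans _ (Lq_norm_ge0 q g)). Qed.

Lemma Lq_norm_measurable q g :
  measurable_fun [set: lebesgue_space R d] ('valL_0 g) ->
  Lq_norm q g = 'N[@lebesgue_rV R d]_q[EFin \o ('valL_0 g)%R]%E.
Proof. by move=> mg; rewrite /Lq_norm asboolT. Qed.

Lemma Lq_norm_nonmeasurable q g :
  ~ measurable_fun [set: lebesgue_space R d] ('valL_0 g) -> Lq_norm q g = +oo%E.
Proof. by move=> mg; rewrite /Lq_norm asboolF. Qed.

(** A non-measurable summand makes the right-hand side infinite, so Minkowski's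
inequality extends to arbitrary functions. *)
Lemma Lq_normD q g h : (1 <= q)%E ->
  (Lq_norm q (g \+ h)%R <= Lq_norm q g + Lq_norm q h)%E.
Proof.
move=> q1.
have [mg|mg] :=
    pselect (measurable_fun [set: lebesgue_space R d] ('valL_0 g)); last first.
  by rewrite (Lq_norm_nonmeasurable q mg) (addye (Lq_norm_neqNy q h)) leey.
have [mh|mh] :=
    pselect (measurable_fun [set: lebesgue_space R d] ('valL_0 h)); last first.
  by rewrite (Lq_norm_nonmeasurable q mh) (addey (Lq_norm_neqNy q g)) leey.
have ext0D : 'valL_0 (g \+ h) = 'valL_0 g \+ 'valL_0 h.
  apply/funext => x; rewrite /valL_ /=.
  by case: ('oinv_set_val x) => //=; rewrite addr0.
rewrite (Lq_norm_measurable q mg) (Lq_norm_measurable q mh).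
rewrite Lq_norm_measurable ext0D; last exact: measurable_funD.
exact: eminkowski.
Qed.

End LqNorm.

(** * Function Hilbert spaces and the regularized functional *)

(** Both bounds hold because b^2 + lambda a^2 <= (b + sqrt lambda a)^2, while the
energy on the left dominates e^2 and lambda t^2 separately. *)
Lemma tradeoff_bounds (R : realType) (lambda a b e t : R) :
  0 < lambda -> 0 <= a -> 0 <= b -> 0 <= e -> 0 <= t ->
  e ^+ 2 + lambda * t ^+ 2 <= b ^+ 2 + lambda * a ^+ 2 ->
  t <= a + b / Num.sqrt lambda /\ e <= b + Num.sqrt lambda * a.
Proof.
move=> lambda0 a0 b0 e0 t0.
have : 0 < Num.sqrt lambda by rewrite sqrtr_gt0.
have : Num.sqrt lambda ^+ 2 = lambda by rewrite sqr_sqrtr// ltW.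
move: (Num.sqrt lambda) => r <- r0 energy.
have cross : b ^+ 2 + r ^+ 2 * a ^+ 2 <= (b + r * a) ^+ 2.
  rewrite -subr_ge0 [leRHS](_ : _ = 2 * (r * a * b)); last by ring.
  by rewrite !mulr_ge0 ?(ltW r0).
have ra0 : 0 <= b + r * a by rewrite addr_ge0 ?mulr_ge0 ?(ltW r0).
split.
  have -> : a + b / r = (b + r * a) / r by field; rewrite gt_eqF.
  rewrite ler_pdivlMr// -ler_sqr ?nnegrE ?mulr_ge0 ?(ltW r0)//.
  apply: le_trans cross; apply: le_trans energy.
  by rewrite exprMn mulrC lerDr sqr_ge0.
rewrite -ler_sqr ?nnegrE//; apply: le_trans cross; apply: le_trans energy.
by rewrite lerDl mulr_ge0 ?sqr_ge0.
Qed.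

Section FunctionHilbertSpace.
Context (R : realType) (T : Type) (H : function_hilbert R T).
Implicit Types (A : set H) (f g s t : H).

Lemma fh_dotC f g : fh_dot H f g = fh_dot H g f.
Proof. by rewrite (@hermC _ false idfun _ (fh_dot H)) expr0 mul1r. Qed.

Lemma fh_dot_sqr f : fh_dot H f f = `|f| ^+ 2.
Proof.
rewrite fh_normE sqr_sqrtr//; have [->|f0] := eqVneq f 0.
  by rewrite linear0r.
by apply/ltW; exact: neq0_dnorm_gt0.
Qed.

Lemma fh_sqr_normD f g :
  `|f + g| ^+ 2 = `|f| ^+ 2 + 2 * fh_dot H f g + `|g| ^+ 2.
Proof.
rewrite -!fh_dot_sqr.
have -> : fh_dot H (f + g) (f + g) = fh_dot H f (f + g) + fh_dot H g (f + g).
  exact: linearDl.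
have dotDr h : fh_dot H h (f + g) = fh_dot H h f + fh_dot H h g.
  exact: linearDr.
by rewrite !dotDr (fh_dotC g f); ring.
Qed.

Lemma fh_funD f g x : fh_fun H (f + g) x = fh_fun H f x + fh_fun H g x.
Proof. by rewrite linearD. Qed.

Lemma fh_funB f g x : fh_fun H (f - g) x = fh_fun H f x - fh_fun H g x.
Proof. by rewrite linearB. Qed.

Lemma closed_subspaceB A f g : closed_subspace A -> A f -> A g -> A (f - g).
Proof.
by move=> [_ lin _] Af Ag; rewrite addrC -scaleN1r; exact: lin.
Qed.

Lemma closed_subspace_sum A n (a : 'I_n -> R) (k : 'I_n -> H) :
  closed_subspace A -> (forall i, A (k i)) -> A (\sum_i a i *: k i).
Proof.
move=> [A0 lin _] Ak; elim/big_rec : _ => // i x _ Ax; exact: lin.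
Qed.

Lemma fh_dot_suml n (a : 'I_n -> R) (k : 'I_n -> H) f :
  fh_dot H (\sum_i a i *: k i) f = \sum_i a i * fh_dot H (k i) f.
Proof.
by rewrite linear_sumlz; apply: eq_bigr => i _; rewrite linearZl_LR.
Qed.

(** The Gram matrix of the k i is positive semidefinite, so its shift M by lambda
is nonsingular: if a M = 0 and s is the combination of the k i with
coefficients a, then 0 = a M a^T = ||s||^2 + lambda |a|^2, whence a = 0. *)
Lemma regularized_gram_solvable n (k : 'I_n -> H) (lambda : R)
    (y : 'I_n -> R) : 0 < lambda ->
  exists a : 'I_n -> R,
    forall j, fh_dot H (\sum_i a i *: k i) (k j) + lambda * a j = y j.
Proof.
move=> lambda0; pose M := \matrix_(i, j) fh_dot H (k i) (k j) + lambda%:M.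
have mulME (a : 'rV_n) j :
    (a *m M) 0 j = fh_dot H (\sum_i a 0 i *: k i) (k j) + lambda * a 0 j.
  rewrite mulmxDr mul_mx_scalar !mxE fh_dot_suml; congr (_ + _).
  by apply: eq_bigr => i _; rewrite mxE.
have Mfree : row_free M.
  rewrite -kermx_eq0; apply/eqP/row_matrixP => i0; rewrite row0.
  have : row i0 (kermx M) *m M = 0 by rewrite -row_mul mulmx_ker row0.
  move: (row i0 (kermx M)) => a aM0; pose s := \sum_i a 0 i *: k i.
  have : `|s| ^+ 2 + lambda * \sum_j a 0 j ^+ 2 = 0.
    rewrite -fh_dot_sqr {2}/s fh_dotC fh_dot_suml mulr_sumr -big_split/=.
    rewrite big1// => j _; have := mulME a j; rewrite aM0 mxE -/s fh_dotC => aj.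
    by rewrite expr2 mulrCA -mulrDr -aj mulr0.
  have sum0 : 0 <= \sum_j a 0 j ^+ 2 by apply: sumr_ge0 => j _; exact: sqr_ge0.
  move=> /eqP; rewrite paddr_eq0 ?sqr_ge0// ?mulr_ge0 ?(ltW lambda0)//.
  move=> /andP[_]; rewrite mulf_eq0 (gt_eqF lambda0)/=.
  rewrite psumr_eq0 => [/allP a0|j _]; last exact: sqr_ge0.
  apply/rowP => j; rewrite mxE; apply/eqP; rewrite -sqrf_eq0.
  by apply: (implyP (a0 j _)); rewrite ?mem_index_enum.
rewrite row_free_unit in Mfree.
pose b := (\row_j y j) *m invmx M; exists (b 0) => j.
by rewrite -mulME /b mulmxKV// mxE.
Qed.

Section RegularizedApprox.
Context (A : set H) (A_closed : closed_subspace A).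
Context (N : nat) (X : 'I_N -> T) (lambda : R) (lambda0 : 0 < lambda).

Local Notation J f :=
  (fun s => \sum_j `|fh_fun H f (X j) - fh_fun H s (X j)| ^+ 2
            + lambda * `|s| ^+ 2).

(** The normal equations cancel the part of J f (s + h) - J f s that is linear in
h, and the quadratic part is nonnegative. *)
Lemma regularized_functional_le f s :
  A s ->
  (forall h, A h -> lambda * fh_dot H s h =
    \sum_j (fh_fun H f (X j) - fh_fun H s (X j)) * fh_fun H h (X j)) ->
  forall t, A t -> J f s <= J f t.
Proof.
move=> As normal_eq t At; have Ah := closed_subspaceB A_closed At As.
have := normal_eq _ Ah; set h := t - s => sh.
have -> : t = s + h by rewrite addrC subrK.
rewrite fh_sqr_normD -subr_ge0.
rewrite [leRHS](_ : _ = \sum_j fh_fun H h (X j) ^+ 2 + lambda * `|h| ^+ 2).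
  rewrite addr_ge0 ?mulr_ge0 ?sqr_ge0 ?(ltW lambda0)// sumr_ge0// => j _.
  exact: sqr_ge0.
rewrite [lambda * (_ + _)](_ : _ =
  lambda * `|s| ^+ 2 + 2 * (lambda * fh_dot H s h) + lambda * `|h| ^+ 2);
  last by ring.
rewrite sh.
have -> : \sum_j `|fh_fun H f (X j) - fh_fun H (s + h) (X j)| ^+ 2 =
  \sum_j `|fh_fun H f (X j) - fh_fun H s (X j)| ^+ 2 +
  \sum_j fh_fun H h (X j) ^+ 2 -
  2 * \sum_j (fh_fun H f (X j) - fh_fun H s (X j)) * fh_fun H h (X j).
  rewrite mulr_sumr -sumrN -!big_split/=; apply: eq_bigr => j _.
  by rewrite !real_normK ?num_real// fh_funD; ring.
ring.
Qed.

(** The representer theorem: a solution a of the shifted Gram system with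
right-hand side f (X j) has residuals f (X j) - s (X j) = lambda a_j, which are
the normal equations for s once evaluations on A are written as products with
the k j. *)
Lemma regularized_approx_argmin K f : reproducing_kernel A K ->
  is_argmin A (J f) (regularized_approx A X lambda f).
Proof.
move=> AK; have [k Pk] := choice (fun j => AK (X j)).
have [a aP] := regularized_gram_solvable k (fun j => fh_fun H f (X j)) lambda0.
pose s := \sum_j a j *: k j.
have As : A s by apply: closed_subspace_sum => // j; have [] := Pk j.
have evalE h j : A h -> fh_fun H h (X j) = fh_dot H h (k j).
  by move=> Ah; have [_ _] := Pk j; apply.
apply: (@xgetPex _ 0 (is_argmin A (J f))); exists s; split => //.
apply: regularized_functional_le => // h Ah.
rewrite /s fh_dot_suml mulr_sumr; apply: eq_bigr => j _.
rewrite -aP -(evalE _ _ As) -/s addrAC subrr add0r.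
by rewrite (evalE _ _ Ah) (fh_dotC h) mulrA.
Qed.

Local Notation l2X g := (lp_norm 2%:E (fh_fun H g \o X)).

Lemma fh_funD_comp f g :
  fh_fun H (f + g) \o X = (fh_fun H f \o X) \+ (fh_fun H g \o X).
Proof. by apply/funext => j /=; exact: fh_funD. Qed.

(** The competitor f1 leaves the residual f2 at the sampling points. *)
Lemma argmin_energy_le f f1 f2 s : f = f1 + f2 -> A f1 ->
  is_argmin A (J f) s ->
  l2X (f - s) ^+ 2 + lambda * `|s| ^+ 2 <= l2X f2 ^+ 2 + lambda * `|f1| ^+ 2.
Proof.
move=> ff Af1 [_ /(_ _ Af1)].
have energyE t : \sum_j `|fh_fun H f (X j) - fh_fun H t (X j)| ^+ 2 =
    l2X (f - t) ^+ 2.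
  apply: (etrans _ (esym (sqr_lp_norm2 _))).
  by apply: eq_bigr => j _ /=; rewrite real_normK ?num_real// fh_funB.
by rewrite !energyE [in f - f1]ff addrAC subrr add0r.
Qed.

End RegularizedApprox.

Lemma ler_norm_orthogonalD f g : fh_dot H f g = 0 -> `|f| <= `|f + g|.
Proof.
move=> fg0; rewrite -ler_sqr ?nnegrE ?normr_ge0// fh_sqr_normD fg0.
by rewrite mulr0 addr0 lerDl sqr_ge0.
Qed.

End FunctionHilbertSpace.

(** * The error bound *)

Theorem theorem2p4 (R : realType) (d : nat) (Omega : set 'rV[R]_d.+1)
  (Omega_neq0 : Omega !=set0) (Omega_open : open Omega)
  (Omega_connected : connected Omega)
  (H : function_hilbert R Omega)
  (K : Omega -> Omega -> R) (HK : reproducing_kernel [set: H] K)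
  (H1 : set H) (H1_closed : closed_subspace H1)
  (K1 : Omega -> Omega -> R) (HK1 : reproducing_kernel H1 K1)
  (p q : \bar R) (p_ge1 : (1 <= p)%E) (q_ge1 : (1 <= q)%E)
  (N : nat) (X : 'I_N -> Omega) (X_inj : injective X)
  (lambda : R) (lambda_gt0 : 0 < lambda)
  (C : R) (C_gt0 : 0 < C)
  (F1 F2 : nat -> R) (F1_ge0 : forall n, 0 <= F1 n)
  (F2_ge0 : forall n, 0 <= F2 n)
  (sampling : forall g : H, H1 g ->
    (Lq_norm q (fh_fun H g) <=
     (C * (F1 N * `|g| + F2 N * lp_norm p (fh_fun H g \o X)))%:E)%E)
  (f f1 f2 : H) (Hf1 : H1 f1) (Hf2 : orthogonal_complement H1 f2)
  (Hf : f = f1 + f2) :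
  (Lq_norm q (fh_fun H (f - regularized_approx H1 X lambda f)%R) <=
   Lq_norm q (fh_fun H f2)
   + (C * (2 * F1 N + lp_const N p * F2 N * Num.sqrt lambda) * `|f|)%:E
   + (C * (F1 N / Num.sqrt lambda + 2 * lp_const N p * F2 N)
      * lp_norm 2%:E (fh_fun H f2 \o X))%:E)%E.
Proof.
set s := regularized_approx H1 X lambda f.
have smin := regularized_approx_argmin H1_closed X lambda_gt0 f HK1.
rewrite -/s in smin.
pose g := f1 - s; have H1g : H1 g by apply: closed_subspaceB => //; exact: smin.1.
have r0 : 0 < Num.sqrt lambda by rewrite sqrtr_gt0.
have norm_f1 : `|f1| <= `|f|.
  by rewrite Hf ler_norm_orthogonalD// fh_dotC; exact: Hf2.
pose b := lp_norm 2%:E (fh_fun H f2 \o X).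
have b0 : 0 <= b by exact: lp_norm2_ge0.
have [s_le res_le] :=
  tradeoff_bounds lambda_gt0 (normr_ge0 f1) b0 (lp_norm2_ge0 _) (normr_ge0 s)
    (argmin_energy_le Hf Hf1 smin).
have norm_g : `|g| <= 2 * `|f| + b / Num.sqrt lambda.
  apply: (le_trans (ler_normB _ _)).
  by move: (b / _) s_le => c s_le; lra.
have g_X : lp_norm 2%:E (fh_fun H g \o X) <= 2 * b + Num.sqrt lambda * `|f|.
  have -> : g = (f - s) + - f2 by rewrite /g Hf (addrAC f1 f2) addrK.
  rewrite fh_funD_comp; apply: (le_trans (ler_lp_norm2D _ _)).
  have -> : fh_fun H (- f2) \o X = \- (fh_fun H f2 \o X).
    by apply/funext => j /=; rewrite linearN.
  rewrite lp_norm2N -/b.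
  have : Num.sqrt lambda * `|f1| <= Num.sqrt lambda * `|f| by rewrite ler_pM2l.
  lra.
have c0 : 0 <= lp_const N p :> R.
  rewrite /lp_const; case: p {p_ge1 sampling} => // r.
  by case: ifP => // _; exact: powR_ge0.
have samp_g : (Lq_norm q (fh_fun H g) <=
    (C * (2 * F1 N + lp_const N p * F2 N * Num.sqrt lambda) * `|f|)%:E +
    (C * (F1 N / Num.sqrt lambda + 2 * lp_const N p * F2 N) * b)%:E)%E.
  apply: (le_trans (sampling _ H1g)); rewrite -EFinD lee_fin.
  have lp_g : lp_norm p (fh_fun H g \o X) <=
      lp_const N p * (2 * b + Num.sqrt lambda * `|f|).
    by apply: (le_trans (lp_norm_le_const _ p_ge1)); rewrite ler_wpM2l.
  apply: (@le_trans _ _ (C * (F1 N * (2 * `|f| + b / Num.sqrt lambda) +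
      F2 N * (lp_const N p * (2 * b + Num.sqrt lambda * `|f|))))).
    by rewrite ler_pM2l// lerD// ler_wpM2l.
  by rewrite le_eqVlt; apply/orP; left; apply/eqP; field; rewrite gt_eqF.
have split_le : (Lq_norm q (fh_fun H (f - s)%R) <=
    Lq_norm q (fh_fun H f2) + Lq_norm q (fh_fun H g))%E.
  have -> : fh_fun H (f - s) = fh_fun H f2 \+ fh_fun H g.
    by apply/funext => x /=; rewrite -fh_funD /g Hf addrA (addrC f2).
  exact: (@Lq_normD R d Omega q (fh_fun H f2) (fh_fun H g)).
apply: (le_trans split_le); rewrite -addeA.
exact: (leeD2l _ samp_g).
Qed.
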